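(* Let $d \le n$ be positive integers. Then the set $J(d,n)$ of squares of side lengths of $d$-dimensional hypercubes with vertices in $\mathbb{Z}^n$ is given as follows, according to $n-d$ and the residue of $d$ modulo $4$: \begin{itemize} \item If $n-d=0$: $J(d,n)=I_1$ if $d\equiv 1 \pmod 4$; $J(d,n)=I_2$ if $d\equiv 2 \pmod 4$; $J(d,n)=I_1$ if $d\equiv 3\pmod 4$; $J(d,n)=\mathbb{N}_0$ if $d\equiv 0\pmod 4$. \item If $n-d=1$: $J(d,n)=I_2$ if $d\equiv 1 \pmod 4$; $J(d,n)=I_2$ if $d\equiv 2\pmod 4$; $J(d,n)=\mathbb{N}_0$ if $d\equiv 3\pmod 4$; $J(d,n)=\mathbb{N}_0$ if $d\equiv 0\pmod 4$. \item If $n-d=2$: $J(d,n)=I_3$ if $d\equiv 1\pmod 4$; $J(d,n)=\mathbb{N}_0$ if $d\equiv 2,3,0\pmod 4$. \item If $n-d\ge 3$: $J(d,n)=\mathbb{N}_0$. \end{itemize}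
   Context: $\mathbb{N}_0$ is the set of non-negative integers. For $k\ge 1$, $I_k=\{\sum_{j=1}^k a_j^2 : a_1,\dots,a_k\in\mathbb{Z}\}$ is the set of integers that are sums of $k$ integer squares (so $0\in I_k$). For positive integers $d\le n$, $J(d,n)$ is the set of squares of side lengths of $d$-dimensional hypercubes all of whose vertices lie in $\mathbb{Z}^n$, where the degenerate cube of side length $0$ is allowed. Equivalently (translating one vertex to the origin), $J(d,n)$ is the set of integers $m\ge 0$ for which there exist $v_1,\dots,v_d\in\mathbb{Z}^n$ with $\langle v_i,v_j\rangle=0$ for $i\ne j$ and $\langle v_i,v_i\rangle=m$ for all $i$, where $\langle\cdot,\cdot\rangle$ is the standard Euclidean inner product. *)

(* Defs.v *)
From HB Require Import structures.
From mathcomp Require Import all_boot all_order all_algebra.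
From mathcomp Require Import all_classical all_reals.

Set Implicit Arguments.
Unset Strict Implicit.
Unset Printing Implicit Defensive.

Import Order.TTheory GRing.Theory Num.Theory.

Local Open Scope classical_set_scope.
Local Open Scope ring_scope.

Definition dot (R : realType) (n : nat) (u w : 'rV[R]_n) : R :=
  \sum_(k < n) u ord0 k * w ord0 k.

(* A d-dimensional hypercube in R^n is given by one of its vertices p and by
   the d edge vectors issuing from p; s = 0 is the degenerate cube. *)
Definition is_hypercube (R : realType) (d n : nat)
    (p : 'rV[R]_n) (v : 'I_d -> 'rV[R]_n) (s : R) : Prop :=
  [/\ 0 <= s,
      (forall i j : 'I_d, i != j -> dot (v i) (v j) = 0)
    & (forall i : 'I_d, dot (v i) (v i) = s ^+ 2)].

(* The 2^d vertices are indexed by the subsets of the set of edge vectors. *)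
Definition cube_vertex (R : realType) (d n : nat)
    (p : 'rV[R]_n) (v : 'I_d -> 'rV[R]_n) (A : {set 'I_d}) : 'rV[R]_n :=
  p + \sum_(i in A) v i.

Definition lattice_point (R : realType) (n : nat) (x : 'rV[R]_n) : Prop :=
  forall k : 'I_n, x ord0 k \is a Num.int.

Definition lattice_cube_side (R : realType) (d n : nat) (s : R) : Prop :=
  exists (p : 'rV[R]_n) (v : 'I_d -> 'rV[R]_n),
    is_hypercube p v s /\
    forall A : {set 'I_d}, lattice_point (cube_vertex p v A).

(* A set of real numbers: integrality of its elements is not built in. *)
Definition J (R : realType) (d n : nat) : set R :=
  [set s ^+ 2 | s in [set s : R | lattice_cube_side d n s]].

Definition sums_of_squares (k : nat) : set int :=
  [set m | exists a : 'I_k -> int, m = \sum_(j < k) a j ^+ 2].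

Definition nonneg_ints : set int := [set m | 0 <= m].

(* I_ R k and N0 R are these sets of integers viewed inside R, so that they can
   be compared with J R d n. *)
Definition I_ (R : realType) (k : nat) : set R :=
  [set m%:~R | m in sums_of_squares k].

Definition N0 (R : realType) : set R := [set m%:~R | m in nonneg_ints].

Arguments J R d n : clear implicits.
Arguments I_ R k : clear implicits.
Arguments N0 R : clear implicits.

(* Main.v *)
(* Up to translation, a d-cube of squared side m in Z^n is an integer d x n
   matrix A with A A^T = m I.  By Lagrange's theorem every m >= 0 is the norm of an integral
   quaternion, so 4 x 4 blocks always exist; this reduces the constructions to
   the d mod 4 remaining rows.  Conversely, over Q, multiplying four rows of A
   by the inverse of such a block makes them orthonormal, and Witt cancellation
   removes four rows and four columns.  What is left are d mod 4 rational rows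
   with n - d more columns, which exhibit m as a sum of few rational squares
   (after cancelling the cross product of the two rows in the case 2 x 3, or by
   taking determinants when d = n is odd), hence, by the Davenport-Cassels
   argument, as a sum of as many integer squares. *)
Require Import Defs.
From HB Require Import structures.
From mathcomp Require Import all_boot all_order all_algebra.
From mathcomp Require Import all_classical all_reals.
From mathcomp Require Import zify ring lra.

Import Order.TTheory GRing.Theory Num.Theory.

Set Implicit Arguments.
Unset Strict Implicit.
Unset Printing Implicit Defensive.

Local Open Scope ring_scope.

(** * From rational to integer sums of at most three squares *)

Lemma nearest_multiple (t a : int) :
  0 < t -> exists b : int, 4 * (a - t * b) ^+ 2 <= t ^+ 2.
Proof.
(* The floor of [a / t + 1 / 2], an integer nearest to [a / t]. *)
move=> t_gt0; exists ((2 * a + t) %/ (2 * t))%Z.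
have t2_gt0 : 0 < 2 * t by lia.
have := divz_eq (2 * a + t) (2 * t).
have := modz_ge0 (2 * a + t) (lt0r_neq0 t2_gt0).
have := ltz_pmod (2 * a + t) t2_gt0.
move: (_ %/ _)%Z (_ %% _)%Z => b r.
set s := a - t * b => r_lt r_ge e.
have : - t <= 2 * s <= t by rewrite /s; lia.
nia.
Qed.

(* The second intersection of the sphere |x|^2 = m with the line through the
   rational point [a / t] and its nearest lattice point [b] has denominator
   [t' < t]. *)
Lemma davenport_cassels_int (k : nat) (m : int) (t : nat) (a : 'I_k -> int) :
  (k <= 3)%N -> (0 < t)%N -> m * t%:Z ^+ 2 = \sum_i a i ^+ 2 ->
  exists b : 'I_k -> int, m = \sum_i b i ^+ 2.
Proof.
move=> k_le3; elim/ltn_ind: t a => t IH a t_gt0 mt2E.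
have t_gt0' : 0 < t%:Z by lia.
pose b i := xchoose (nearest_multiple (a i) t_gt0').
have bP i : 4 * (a i - t%:Z * b i) ^+ 2 <= t%:Z ^+ 2 := xchooseP (nearest_multiple (a i) t_gt0').
pose r i := a i - t%:Z * b i.
pose B := \sum_i b i ^+ 2; pose P := \sum_i a i * b i.
pose t' := m * t%:Z - 2 * P + t%:Z * B.
have rE : \sum_i r i ^+ 2 = t%:Z * t'.
  rewrite (_ : t%:Z * t' = m * t%:Z ^+ 2 - 2 * t%:Z * P + t%:Z ^+ 2 * B); last by rewrite /t'; ring.
  rewrite mt2E /P /B !mulr_sumr -sumrB -big_split; apply: eq_bigr => i _ /=.
  by rewrite /r; ring.
have r_ge0 : 0 <= t%:Z * t' by rewrite -rE sumr_ge0 // => i _; rewrite sqr_ge0.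
(* At most three squares, each at most [t ^+ 2 / 4]: this makes [t' < t] strict, where four squares
   would only give [t' <= t]. *)
have r_lt : 4 * (t%:Z * t') <= 3 * t%:Z ^+ 2.
  rewrite -rE mulr_sumr (le_trans (ler_sum _ (fun i _ => bP i))) //.
  by rewrite sumr_const card_ord -mulr_natl natz; nia.
have [t'0|t'_neq0] := eqVneq t' 0.
  have r0 i : r i = 0.
    apply/eqP; rewrite -(sqrf_eq0 (r i)).
    move/eqP: rE; rewrite t'0 mulr0 psumr_eq0; last by move=> j _; rewrite sqr_ge0.
    by move=> /allP/(_ i (mem_index_enum i)).
  exists b; apply: (@mulIf _ (t%:Z ^+ 2)); first by rewrite sqrf_eq0; lia.
  rewrite mt2E mulr_suml; apply: eq_bigr => i _.
  by rewrite (_ : a i = t%:Z * b i); [ring | have := r0 i; rewrite /r; lia].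
have [t'_ge0 t'_lt] : 0 <= t' /\ t' < t%:Z by nia.
have t'E : `|t'|%N%:Z = t' by rewrite gez0_abs.
(* On the line [b + s r], the roots [s] of [|b + s r|^2 = m] have product [(B - m) / (t t')]; one is
   [1 / t], so the other is [(B - m) / t']. *)
apply: (IH `|t'|%N _ (fun i => t' * b i + (B - m) * r i)); [by lia|by lia|].
rewrite t'E.
have -> : \sum_i (t' * b i + (B - m) * r i) ^+ 2 =
  t' ^+ 2 * B + 2 * t' * (B - m) * P - 2 * t' * (B - m) * t%:Z * B
  + (B - m) ^+ 2 * (t%:Z * t').
  rewrite -rE /B /P !mulr_sumr -!big_split -sumrB -!big_split /=.
  by apply: eq_bigr => i _; rewrite /r; ring.
by rewrite /t'; ring.
Qed.

Lemma davenport_cassels (k : nat) (m : int) (x : 'I_k -> rat) :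
  (k <= 3)%N -> m%:~R = \sum_i x i ^+ 2 ->
  exists b : 'I_k -> int, m = \sum_i b i ^+ 2.
Proof.
move=> k_le3 mE; pose t := \prod_i denq (x i).
have t_gt0 : 0 < t by apply: prodr_gt0 => i _; exact: denq_gt0.
pose a i := numq (x i) * \prod_(j | j != i) denq (x j).
have aE i : (a i)%:~R = x i * t%:~R :> rat.
  rewrite /a [t](bigD1 i) //= !intrM mulrA; congr (_ * _).
  exact: numqE.
apply: (@davenport_cassels_int k m `|t|%N a) => //; first by lia.
rewrite gtz0_abs //; apply: (@intr_inj rat).
rewrite rmorphM rmorphXn /= mE rmorph_sum mulr_suml; apply: eq_bigr => i _.
by rewrite rmorphXn /= aE exprMn.
Qed.

(** * Lagrange's four-square theorem *)

Definition sum4 (m : int) : Prop :=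
  exists a b c d : int, m = a ^+ 2 + b ^+ 2 + c ^+ 2 + d ^+ 2.

(** Euler's identity: the witnesses are the components of [x + y i + z j + w k] times the conjugate
    of [a + b i + c j + d k]. *)
Lemma sum4M (m n : int) : sum4 m -> sum4 n -> sum4 (m * n).
Proof.
move=> [a [b [c [d ->]]]] [x [y [z [w ->]]]].
exists (a * x + b * y + c * z + d * w), (a * y - b * x + c * w - d * z),
  (a * z - c * x + d * y - b * w), (a * w - d * x + b * z - c * y).
by ring.
Qed.

(** Four squares give only [0 <= t' <= t]. Both ends are excluded because they make [t] divide [p]:
    [t' = 0] makes every [r] vanish, and [t' = t] makes every [2 r] equal to [t] or [- t]. *)
Lemma descent_bound (p t t' B r1 r2 r3 r4 b1 b2 b3 b4 : int) :
  0 < t -> (forall q : int, p <> t * q) ->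
  4 * r1 ^+ 2 <= t ^+ 2 -> 4 * r2 ^+ 2 <= t ^+ 2 ->
  4 * r3 ^+ 2 <= t ^+ 2 -> 4 * r4 ^+ 2 <= t ^+ 2 ->
  t * t' = r1 ^+ 2 + r2 ^+ 2 + r3 ^+ 2 + r4 ^+ 2 ->
  p = t' + t * B + 2 * (r1 * b1 + r2 * b2 + r3 * b3 + r4 * b4) ->
  0 < t' < t.
Proof.
move=> t_gt0 t_ndiv r1P r2P r3P r4P rE pE.
have [r1_ge0 r2_ge0 r3_ge0 r4_ge0] :
    [/\ 0 <= r1 ^+ 2, 0 <= r2 ^+ 2, 0 <= r3 ^+ 2 & 0 <= r4 ^+ 2].
  by split; exact: sqr_ge0.
have t'_ge0 : 0 <= t' by rewrite -(pmulr_rge0 _ t_gt0) rE !addr_ge0.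
have t'_le : t' <= t.
  rewrite -(ler_pM2l t_gt0) rE -expr2; clear - r1P r2P r3P r4P; lia.
have t'_neq0 : t' != 0.
  apply/eqP => t'0; move: rE; rewrite t'0 mulr0 => rE.
  have [/eqP r10 /eqP r20 /eqP r30 /eqP r40] : [/\ r1 == 0, r2 == 0, r3 == 0 & r4 == 0].
    rewrite -(sqrf_eq0 r1) -(sqrf_eq0 r2) -(sqrf_eq0 r3) -(sqrf_eq0 r4).
    by clear - rE r1_ge0 r2_ge0 r3_ge0 r4_ge0; split; lia.
  by apply: (t_ndiv B); rewrite pE t'0 r10 r20 r30 r40; ring.
rewrite lt0r t'_neq0 t'_ge0 lt_neqAle t'_le !andbT /=.
apply/eqP => t'E; rewrite t'E -expr2 in rE.
have half (r : int) : 4 * r ^+ 2 = t ^+ 2 -> exists e : int, 2 * r = t * e.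
  move=> re; have : (2 * r) ^+ 2 == t ^+ 2 by apply/eqP; rewrite -re; ring.
  by rewrite eqf_sqr => /orP[/eqP ->|/eqP ->]; [exists 1|exists (-1)]; ring.
have [r1E r2E r3E r4E] : [/\ 4 * r1 ^+ 2 = t ^+ 2, 4 * r2 ^+ 2 = t ^+ 2,
    4 * r3 ^+ 2 = t ^+ 2 & 4 * r4 ^+ 2 = t ^+ 2].
  by clear - rE r1P r2P r3P r4P; split; lia.
have [[e1 e1E] [e2 e2E]] := (half _ r1E, half _ r2E).
have [[e3 e3E] [e4 e4E]] := (half _ r3E, half _ r4E).
apply: (t_ndiv (1 + B + e1 * b1 + e2 * b2 + e3 * b3 + e4 * b4)).
by rewrite pE t'E !mulrDr !mulrA e1E e2E e3E e4E; ring.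
Qed.

(* With [a = t b + r], the quaternion [a * conj r] has norm [p t * t t'] and is
   divisible by [t]; the quotient is [p - a * conj b], of norm [p t']. *)
Lemma sum4_descent (p t : nat) : prime p -> (1 < t < p)%N -> sum4 (p%:Z * t%:Z) ->
  exists2 t' : nat, (0 < t' < t)%N & sum4 (p%:Z * t'%:Z).
Proof.
move=> p_pr /andP[t_gt1 t_ltp] [a1 [a2 [a3 [a4 ptE]]]].
have t_ndiv (q : int) : p%:Z <> t%:Z * q.
  move=> pE; have /primeP[_ /(_ t)] := p_pr.
  have -> : (t %| p)%N.
    apply/dvdnP; exists `|q|%N; move/(congr1 absz): pE; rewrite abszM /= mulnC; lia.
  by move=> /(_ isT); lia.
have t_gt0 : 0 < t%:Z by lia.
have [b1 b1P] := nearest_multiple a1 t_gt0.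
have [b2 b2P] := nearest_multiple a2 t_gt0.
have [b3 b3P] := nearest_multiple a3 t_gt0.
have [b4 b4P] := nearest_multiple a4 t_gt0.
pose P := a1 * b1 + a2 * b2 + a3 * b3 + a4 * b4.
pose B := b1 ^+ 2 + b2 ^+ 2 + b3 ^+ 2 + b4 ^+ 2.
pose t' := p%:Z - 2 * P + t%:Z * B.
have pt'E : p%:Z * t' = (p%:Z - P) ^+ 2 + (a1 * b2 - a2 * b1 + a3 * b4 - a4 * b3) ^+ 2 +
  (a1 * b3 - a3 * b1 + a4 * b2 - a2 * b4) ^+ 2 + (a1 * b4 - a4 * b1 + a2 * b3 - a3 * b2) ^+ 2.
  transitivity (p%:Z ^+ 2 - 2 * p%:Z * P + (p%:Z * t%:Z) * B); first by rewrite /t'; ring.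
  by rewrite ptE /B /P; ring.
pose r1 := a1 - t%:Z * b1; pose r2 := a2 - t%:Z * b2.
pose r3 := a3 - t%:Z * b3; pose r4 := a4 - t%:Z * b4.
have rE : t%:Z * t' = r1 ^+ 2 + r2 ^+ 2 + r3 ^+ 2 + r4 ^+ 2.
  transitivity (p%:Z * t%:Z - 2 * t%:Z * P + t%:Z ^+ 2 * B); first by rewrite /t'; ring.
  by rewrite ptE /r1 /r2 /r3 /r4 /P /B; ring.
have pE : p%:Z = t' + t%:Z * B + 2 * (r1 * b1 + r2 * b2 + r3 * b3 + r4 * b4).
  by rewrite /t' /r1 /r2 /r3 /r4 /P /B; ring.
have /andP[t'_gt0 t'_lt] := descent_bound t_gt0 t_ndiv b1P b2P b3P b4P rE pE.
exists `|t'|%N; first by clear - t'_gt0 t'_lt; lia.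
by rewrite gtz0_abs // pt'E; do 4 eexists; reflexivity.
Qed.

(** Pigeonhole: for [x] and [y] between 0 and [(p - 1) / 2], the values [x^2] and [- 1 - y^2] fill
    [(p + 1) / 2] classes each, hence share one. The size bound lets the descent start from a
    multiple [p t] with [t < p]. *)
Lemma prime_dvd_sum_two_squares_plus_one (p : nat) : prime p -> odd p ->
  exists x y : nat, (p %| x ^ 2 + y ^ 2 + 1)%N /\ (x ^ 2 + y ^ 2 + 1 < p ^ 2)%N.
Proof.
move=> p_pr p_odd; pose h := p./2.
have pE : p = (h.*2.+1)%N by rewrite -[LHS]odd_double_half p_odd.
have p_gt1 := prime_gt1 p_pr.
have natr0 (n : nat) : (n%:R == 0 :> 'F_p) = (p %| n)%N.
  by rewrite (dvdn_pcharf (pchar_Fp p_pr)).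
have sqr_inj : injective (fun x : 'I_h.+1 => (x%:R : 'F_p) ^+ 2).
  move=> x y /eqP; rewrite eqf_sqr => /orP[/eqP xy|].
    apply: val_inj => /=; have /(congr1 val) := xy.
    rewrite /= !val_Fp_nat // !modn_small //; have := ltn_ord x; have := ltn_ord y; lia.
  (* If [x = - y] modulo [p], then [x + y <= p - 1] leaves only [x = y = 0]. *)
  rewrite -addr_eq0 -natrD natr0 => /dvdnP[q xyE].
  apply: val_inj => /=; have := ltn_ord x; have := ltn_ord y.
  by case: q xyE => [|q]; rewrite ?mulSn; lia.
have neg_inj : injective (fun y : 'I_h.+1 => - 1 - (y%:R : 'F_p) ^+ 2).
  by move=> x y /addrI /oppr_inj /sqr_inj.
pose A := [set (x%:R : 'F_p) ^+ 2 | x : 'I_h.+1].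
pose B := [set - 1 - (y%:R : 'F_p) ^+ 2 | y : 'I_h.+1].
have cardA : #|A| = h.+1 by rewrite card_imset // card_ord.
have cardB : #|B| = h.+1 by rewrite card_imset // card_ord.
have /finset.set0Pn[_ /finset.setIP[/imsetP[x _ ->] /imsetP[y _ xyE]]] : A :&: B != finset.set0.
  apply/negP => /eqP AB0; have := cardsUI A B; rewrite AB0 cards0 addn0 cardA cardB.
  have := max_card (A :|: B); rewrite card_Fp //; lia.
exists x, y; split; last by have := ltn_ord x; have := ltn_ord y; nia.
by rewrite -natr0 !natrD !natrX xyE; apply/eqP; ring.
Qed.

Lemma sum4_prime (p : nat) : prime p -> sum4 p%:Z.
Proof.
move=> p_pr; have [->|p_odd] := even_prime p_pr; first by exists 1, 1, 0, 0.
have [x [y [/dvdnP[t xyE] xy_lt]]] := prime_dvd_sum_two_squares_plus_one p_pr p_odd.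
have p_gt1 := prime_gt1 p_pr.
have pt : sum4 (p%:Z * t%:Z).
  by exists x%:Z, y%:Z, 1, 0; rewrite mulrC -PoszM -xyE; lia.
have : (0 < t < p)%N by nia.
elim/ltn_ind: t {xyE} pt => t IH pt t_bnd.
have [t1|t_neq1] := eqVneq t 1%N; first by rewrite t1 mulr1 in pt.
have [|t' t'_bnd pt'] := sum4_descent p_pr _ pt; first by lia.
by apply: (IH t') => //; lia.
Qed.

Lemma lagrange_four_squares (m : nat) : sum4 m%:Z.
Proof.
elim/ltn_ind: m => m IH.
have [m_le1|m_gt1] := leqP m 1.
  by exists m%:Z, 0, 0, 0; case: m m_le1 {IH} => [|[|]].
have p_pr := pdiv_prime m_gt1; have := prime_gt1 p_pr => p_gt1.
rewrite -(divnK (pdiv_dvd m)) PoszM; apply: sum4M (sum4_prime p_pr).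
by apply: IH; rewrite ltn_Pdiv //; lia.
Qed.

(** * Matrices with orthogonal rows of equal norm *)

(** The ring varies because cubes live over [int] while cancellation divides by [m] in [rat]. The
    case [d = 0] is what remains when four divides the number of rows. *)
Definition scaled_frame (F : comPzRingType) (d n : nat) (m : F) : Prop :=
  exists A : 'M[F]_(d, n), A *m A^T = m%:M.

Lemma gram_entry (F : comPzRingType) (d n : nat) (A : 'M[F]_(d, n)) i j :
  (A *m A^T) i j = \sum_k A i k * A j k.
Proof. by rewrite mxE; apply: eq_bigr => k _; rewrite mxE. Qed.

Lemma scaled_frame_block (F : comPzRingType) d1 n1 d2 n2 (m : F) :
  scaled_frame d1 n1 m -> scaled_frame d2 n2 m ->
  scaled_frame (d1 + d2) (n1 + n2) m.
Proof.
move=> [A AP] [B BP]; exists (block_mx A 0 0 B).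
rewrite tr_block_mx mulmx_block !trmx0 !mul0mx !mulmx0 !addr0 !add0r AP BP.
by rewrite -scalar_mx_block.
Qed.

Lemma scaled_frame0 (F : comPzRingType) n (m : F) : scaled_frame 0 n m.
Proof. by exists 0; apply/matrixP => -[]. Qed.

Lemma scaled_frame_widen (F : comPzRingType) d n n' (m : F) :
  (n <= n')%N -> scaled_frame d n m -> scaled_frame d n' m.
Proof.
move=> /subnKC <- frame; rewrite -[d]addn0.
exact: scaled_frame_block frame (scaled_frame0 _ _).
Qed.

Lemma scaled_frame_sub (F : comPzRingType) d d' n (m : F) :
  (d' <= d)%N -> scaled_frame d n m -> scaled_frame d' n m.
Proof.
move=> /subnKC <- [A]; rewrite -(vsubmxK A) tr_col_mx mul_col_row scalar_mx_block.
by move=> /eq_block_mx[AP _ _ _]; exists (usubmx A).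
Qed.

Lemma scaled_frame_sqr (F : comPzRingType) d (a : F) : scaled_frame d d (a ^+ 2).
Proof. by exists a%:M; rewrite tr_scalar_mx -scalar_mxM. Qed.

Lemma scaled_frame1 (F : comPzRingType) n (a : 'I_n -> F) :
  scaled_frame 1 n (\sum_i a i ^+ 2).
Proof.
exists (\row_i a i); apply/matrixP => i j; rewrite gram_entry !ord1 mxE eqxx mulr1n.
by apply: eq_bigr => k _; rewrite mxE expr2.
Qed.

Lemma scaled_frame22 (F : comNzRingType) (a b : F) : scaled_frame 2 2 (a ^+ 2 + b ^+ 2).
Proof.
suff : scaled_frame (1 + 1) (1 + 1) (a ^+ 2 + b ^+ 2) by [].
exists (block_mx a%:M b%:M (- b)%:M a%:M).
rewrite tr_block_mx mulmx_block !tr_scalar_mx -!scalar_mxM -!raddfD scalar_mx_block.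
by congr block_mx; apply/matrixP => i j; rewrite !ord1 !mxE /=; ring.
Qed.

(** With [q = a + b i + c j + d k], the rows are the quaternions [q], [i q], [j q] and [k q]. *)
Lemma scaled_frame44 (F : comNzRingType) (a b c d : F) :
  scaled_frame 4 4 (a ^+ 2 + b ^+ 2 + c ^+ 2 + d ^+ 2).
Proof.
pose rows := [:: [:: a; b; c; d]; [:: - b; a; - d; c];
                 [:: - c; d; a; - b]; [:: - d; - c; b; a]].
exists (\matrix_(i, j) nth 0 (nth [::] rows i) j).
apply/matrixP => i j; rewrite gram_entry !mxE !big_ord_recr big_ord0 /= !mxE /=.
case: i => [[|[|[|[|//]]]] /= ?]; case: j => [[|[|[|[|//]]]] /= ?];
  rewrite ?mulr1n ?mulr0n; ring.
Qed.

(* Witt cancellation: the reflection carrying the unit row [u] to the first basis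
   vector (available after a sign change when [u] is that vector) sends the
   orthogonal rows [v i] to rows with zero first coordinate. *)
Lemma cancel_unit_row (F : realFieldType) (p n : nat) (M : 'M[F]_(1 + p, 1 + n))
    (G : 'M[F]_p) :
  M *m M^T = block_mx 1%:M 0 0 G -> exists B : 'M[F]_(p, n), B *m B^T = G.
Proof.
wlog u_neq1 : M / M (lshift p 0) (lshift n 0) != 1.
  move=> main MP; have [u1|] := eqVneq (M (lshift p 0) (lshift n 0)) 1; last by move=> /main; exact.
  apply: (main (block_mx (-1)%:M 0 0 1%:M *m M)).
    rewrite -(submxK M) mulmx_block mul0mx addr0 block_mxEul.
    by rewrite mul_scalar_mx !mxE u1; apply/eqP; lra.
  rewrite trmx_mul mulmxA -(mulmxA _ M) MP tr_block_mx !mulmx_block.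
  rewrite !tr_scalar_mx !trmx0 !(mulmx0, mul0mx, mulmx1, mul1mx, addr0, add0r).
  by rewrite -scalar_mxM mulrNN mulr1.
move=> MP; pose u := M (lshift p 0).
pose v i := M (rshift 1 i).
pose c := (1 - u (lshift n 0))^-1.
have cE : c * (1 - u (lshift n 0)) = 1 by rewrite mulVf // subr_eq0 eq_sym.
have uu : \sum_j u (rshift 1 j) ^+ 2 = 1 - u (lshift n 0) ^+ 2.
  have /matrixP/(_ (lshift p 0) (lshift p 0)) := MP.
  rewrite gram_entry block_mxEul mxE eqxx mulr1n big_split_ord /= big_ord1 => <-.
  by rewrite -expr2 [in RHS]addrAC subrr add0r; apply: eq_bigr => j _; rewrite expr2.
have uv i : \sum_j v i (rshift 1 j) * u (rshift 1 j) = - (v i (lshift n 0) * u (lshift n 0)).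
  have /matrixP/(_ (rshift 1 i) (lshift p 0)) := MP.
  rewrite gram_entry block_mxEdl mxE big_split_ord /= big_ord1 => /eqP.
  by rewrite addrC addr_eq0 => /eqP.
have vv i k : \sum_j v i (rshift 1 j) * v k (rshift 1 j) =
    G i k - v i (lshift n 0) * v k (lshift n 0).
  have /matrixP/(_ (rshift 1 i) (rshift 1 k)) := MP.
  by rewrite gram_entry block_mxEdr big_split_ord /= big_ord1 => <-; rewrite /v; ring.
(* As [v] is orthogonal to [u], the reflection along [u - e_1] sends [v] to [v + c v_1 (u - e_1)];
   its first coordinate is zero and is dropped. *)
exists (\matrix_(i, j) (v i (rshift 1 j) + c * v i (lshift n 0) * u (rshift 1 j))).
apply/matrixP => i k; rewrite gram_entry.
under eq_bigr do rewrite !mxE.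
transitivity (\sum_j v i (rshift 1 j) * v k (rshift 1 j)
  + c * v k (lshift n 0) * (\sum_j v i (rshift 1 j) * u (rshift 1 j))
  + c * v i (lshift n 0) * (\sum_j v k (rshift 1 j) * u (rshift 1 j))
  + c ^+ 2 * v i (lshift n 0) * v k (lshift n 0) * (\sum_j u (rshift 1 j) ^+ 2)).
  by rewrite !mulr_sumr -!big_split; apply: eq_bigr => j _ /=; ring.
rewrite uu !uv vv; set x := u _; set y := v i _; set z := v k _.
(* The factor is [- 1 - 2 c x + c^2 (1 - x^2)], arranged so that two uses of [c (1 - x) = 1]
   annihilate it. *)
transitivity (G i k + y * z * (- 1 - 2 * c * x + c * (c * (1 - x)) * (1 + x))); first by ring.
rewrite cE.
transitivity (G i k + y * z * (- 1 + c * (1 - x))); first by ring.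
by rewrite cE; ring.
Qed.

Lemma cancel_unit_rows (F : realFieldType) (k p n : nat) (M : 'M[F]_(k + p, k + n))
    (G : 'M[F]_p) :
  M *m M^T = block_mx 1%:M 0 0 G -> exists B : 'M[F]_(p, n), B *m B^T = G.
Proof.
elim: k M => [|k IH] M MP.
  exists M; rewrite MP; apply/matrixP => i j.
  by rewrite -[RHS](block_mxEdr (1%:M : 'M_0) 0 0 G); congr (block_mx _ _ _ _ _ _); apply: val_inj.
have [|B BP] := @cancel_unit_row F (k + p) (k + n) M (block_mx 1%:M 0 0 G); last exact: IH BP.
rewrite MP (scalar_mx_block 1 k).
have := @block_mxA F 1 k p 1 k p 1%:M 0 0 0 1%:M 0 0 0 G.
by rewrite /= castmx_id !row_mx0 !col_mx0 => <-.
Qed.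

(** The matrix [m^-1 H^T] is the inverse of [H]; acting on the first four rows, it turns their Gram
    matrix [m I] into [m^-1 H^T H = I]. *)
Lemma scaled_frame_cancel4 (F : realFieldType) (d n : nat) (m : F) :
  m != 0 -> scaled_frame 4 4 m ->
  scaled_frame (4 + d) (4 + n) m -> scaled_frame d n m.
Proof.
move=> m_neq0 [H HP] [A AP].
(* The columns of [H] are orthogonal too, since a one-sided inverse of a square matrix is
   two-sided. *)
have HtP : H^T *m H = m%:M.
  have : H *m (m^-1 *: H^T) = 1%:M by rewrite -scalemxAr HP scale_scalar_mx mulVf.
  move=> /mulmx1C; rewrite -scalemxAl => /(congr1 (fun X => m *: X)).
  by rewrite scalerA divff // scale1r => ->; rewrite scale_scalar_mx mulr1.
apply: (@cancel_unit_rows F 4 d n (block_mx (m^-1 *: H^T) 0 0 1%:M *m A)).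
rewrite trmx_mul mulmxA -(mulmxA _ A) AP mul_mx_scalar -scalemxAl.
rewrite tr_block_mx mulmx_block linearZ /= !trmxK !trmx0 tr_scalar_mx.
rewrite !(mulmx0, mul0mx, mulmx1, mul1mx, addr0, add0r).
rewrite -scalemxAl -scalemxAr HtP scale_block_mx !scaler0 !scale_scalar_mx mulr1.
by rewrite mulVf // mulr1 divff.
Qed.

(** * Reduction of the number of rows modulo four *)

Lemma scaled_frame_map (F K : comNzRingType) (f : {rmorphism F -> K}) d n (m : F) :
  scaled_frame d n m -> scaled_frame d n (f m).
Proof.
by move=> [A AP]; exists (map_mx f A); rewrite map_trmx -map_mxM AP map_scalar_mx.
Qed.

Lemma scaled_frame_ge0 d n (m : int) : (0 < d)%N -> scaled_frame d n m -> 0 <= m.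
Proof.
move=> d_gt0 [A /matrixP/(_ (Ordinal d_gt0) (Ordinal d_gt0))].
rewrite gram_entry mxE eqxx mulr1n => <-.
by apply: sumr_ge0 => k _; rewrite -expr2 sqr_ge0.
Qed.

Lemma scaled_frame_lagrange (m : int) : 0 <= m -> scaled_frame 4 4 m.
Proof.
move=> m_ge0; have [a [b [c [d]]]] := lagrange_four_squares `|m|%N.
by rewrite gez0_abs // => ->; exact: scaled_frame44.
Qed.

Lemma scaled_frame_lagrange_mul4 k (m : int) :
  0 <= m -> scaled_frame (k * 4) (k * 4) m.
Proof.
move=> m_ge0; elim: k => [|k IH]; first exact: scaled_frame0.
by rewrite mulSn; apply: scaled_frame_block; first exact: scaled_frame_lagrange.
Qed.

Lemma scaled_frame_extend d n (m : int) : (d <= n)%N -> 0 <= m ->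
  scaled_frame (d %% 4) (d %% 4 + (n - d)) m -> scaled_frame d n m.
Proof.
move=> le_dn m_ge0 frame.
have := scaled_frame_block (scaled_frame_lagrange_mul4 (d %/ 4) m_ge0) frame.
by rewrite addnA -divn_eq subnKC.
Qed.

Lemma scaled_frame_reduce d n (m : int) : (d <= n)%N -> 0 < m ->
  scaled_frame d n m -> scaled_frame (d %% 4) (d %% 4 + (n - d)) (m%:~R : rat).
Proof.
move=> le_dn m_gt0 /(scaled_frame_map (intmul 1 : {rmorphism int -> rat})).
(* Only the outer occurrences of [d] are split by division; the excess [n - d] stays fixed while
   each step removes four rows and four columns. *)
rewrite -[in X in X -> _](subnKC le_dn) {1 2}(divn_eq d 4) -addnA.
elim: (d %/ 4)%N => // k IH; rewrite mulSn -!addnA => frame; apply: IH.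
apply: scaled_frame_cancel4 frame; first by rewrite intr_eq0 gt_eqF.
exact: scaled_frame_map (scaled_frame_lagrange (ltW m_gt0)).
Qed.

(* The normalized cross product of the two rows is a unit vector orthogonal to
   both, which can be cancelled. *)
Lemma scaled_frame_cross (F : realFieldType) (m : F) :
  m != 0 -> scaled_frame 2 3 m -> scaled_frame 2 2 m.
Proof.
move=> m_neq0 [A AP].
pose x i := A i 0; pose y i := A i (lift ord0 ord0).
pose z i := A i (lift ord0 (lift ord0 ord0)).
pose u : 'rV[F]_3 := \row_k nth 0 [:: y 0 * z 1 - z 0 * y 1;
  z 0 * x 1 - x 0 * z 1; x 0 * y 1 - y 0 * x 1] k.
have dotE i j : x i * x j + y i * y j + z i * z j = m *+ (i == j).
  have /matrixP/(_ i j) := AP.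
  by rewrite gram_entry mxE !big_ord_recl big_ord0 addr0 addrA.
have uu : u *m u^T = (m ^+ 2)%:M.
  apply/matrixP => i j; rewrite !ord1 gram_entry !mxE !big_ord_recl big_ord0 !mxE /= mulr1n.
  have := dotE 0 0; have := dotE 0 1; have := dotE 1 1; rewrite /= mulr1n mulr0n.
  move=> e11 e01 e00.
  transitivity ((x 0 * x 0 + y 0 * y 0 + z 0 * z 0) * (x 1 * x 1 + y 1 * y 1 + z 1 * z 1)
    - (x 0 * x 1 + y 0 * y 1 + z 0 * z 1) ^+ 2); first by ring.
  by rewrite e11 e01 e00; ring.
have Au : A *m u^T = 0.
  apply/matrixP => i j; rewrite mxE [RHS]mxE !big_ord_recl big_ord0 !mxE /=.
  rewrite -/(x i) -/(y i) -/(z i).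
  have [->|->] : i = 0 \/ i = 1; [|by ring|by ring].
  by case: i => [[|[|//]] ?]; [left|right]; exact: val_inj.
have uA : u *m A^T = 0 by apply: trmx_inj; rewrite trmx_mul trmxK Au trmx0.
apply: (@cancel_unit_row F 2 2 (col_mx (m^-1 *: u) A)).
rewrite tr_col_mx mul_col_row AP linearZ /= -!scalemxAr -!scalemxAl Au uA uu !scaler0.
by rewrite !scale_scalar_mx expr2 mulKf // mulVf.
Qed.

(** * Sums of squares and sides of lattice cubes *)

Local Open Scope classical_set_scope.
Local Open Scope ring_scope.

Lemma sums_of_squares0 k : sums_of_squares k 0.
Proof. by exists (fun=> 0); rewrite big1. Qed.

Lemma sums_of_squares_ge0 k : sums_of_squares k `<=` nonneg_ints.
Proof. by move=> _ [a ->]; apply: sumr_ge0 => i _; exact: sqr_ge0. Qed.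

Lemma scaled_frame1_sums k (m : int) : (k <= 3)%N ->
  scaled_frame 1 k (m%:~R : rat) -> sums_of_squares k m.
Proof.
move=> k_le3 [A /matrixP/(_ 0 0)]; rewrite gram_entry mxE eqxx mulr1n => mE.
by apply: (@davenport_cassels k m (A 0)) => //; rewrite -mE; apply: eq_bigr.
Qed.

(** Determinants give [(\det A)^2 = m^d]; with [d = 2 h + 1], [m] is the square of the rational
    [\det A / m^h]. *)
Lemma scaled_frame_odd_square d (m : int) :
  odd d -> scaled_frame d d m -> sums_of_squares 1 m.
Proof.
move=> d_odd [A AP]; have [->|m_neq0] := eqVneq m 0; first exact: sums_of_squares0.
have detE : (\det A) ^+ 2 = m ^+ d by rewrite expr2 -[X in _ * X]det_tr -det_mulmx AP det_scalar.
apply: (@davenport_cassels 1 m (fun=> (\det A)%:~R / m%:~R ^+ d./2)) => //.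
rewrite big_ord1 expr_div_n -exprM -rmorphXn /= detE rmorphXn /=.
rewrite -[in X in X / _](odd_double_half d) d_odd -muln2 addnC addn1 exprS mulfK //.
by rewrite expf_neq0 // intr_eq0.
Qed.

(** Each edge is a difference of two lattice vertices, so the Gram matrix, and with it [s ^+ 2], is
    integral. The condition [0 < d] provides an edge from which [m] is read off. *)
Lemma J_scaled_frame (R : realType) d n : (0 < d)%N ->
  J R d n = [set m%:~R | m in [set m : int | scaled_frame d n m]].
Proof.
move=> d_gt0; apply/seteqP; split => x /=.
  move=> [s [p [v [[s_ge0 v_orth v_norm] latt]]] <-].
  have v_int i k : v i ord0 k \is a Num.int.
    have -> : v i ord0 k =
        cube_vertex p v (finset.set1 i) ord0 k - cube_vertex p v finset.set0 ord0 k.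
      by rewrite /cube_vertex finset.big_set1 finset.big_set0 addr0 mxE addrAC subrr add0r.
    by rewrite rpredB //; exact: latt.
  pose A : 'M[int]_(d, n) := \matrix_(i, k) Num.floor (v i ord0 k).
  have AE i k : (A i k)%:~R = v i ord0 k by rewrite mxE floorK.
  have dotE i j : ((A *m A^T) i j)%:~R = dot (v i) (v j).
    by rewrite gram_entry rmorph_sum; apply: eq_bigr => k _; rewrite rmorphM /= !AE.
  pose i0 := Ordinal d_gt0.
  exists ((A *m A^T) i0 i0); last by rewrite dotE v_norm.
  exists A; apply/matrixP => i j; apply: (@intr_inj R); rewrite dotE [in RHS]mxE.
  have [<-|/v_orth ->] := eqVneq i j; last by rewrite mulr0n.
  by rewrite mulr1n dotE !v_norm.
move=> [m frame <-]; have m_ge0 := scaled_frame_ge0 d_gt0 frame.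
case: frame => A AP; exists (Num.sqrt m%:~R); last by rewrite sqr_sqrtr ?ler0z.
have dotE i j : dot (map_mx intr (row i A)) (map_mx intr (row j A)) = (m *+ (i == j))%:~R :> R.
  have /matrixP/(_ i j) := AP; rewrite gram_entry mxE => <-.
  by rewrite rmorph_sum; apply: eq_bigr => k _; rewrite !mxE rmorphM.
exists 0, (fun i => map_mx intr (row i A)); split.
  split=> [|i j /negPf ij|i]; first exact: sqrtr_ge0.
    by rewrite dotE ij.
  by rewrite dotE eqxx sqr_sqrtr ?ler0z.
move=> B k; rewrite /cube_vertex add0r summxE rpred_sum // => i _.
by rewrite !mxE intr_int.
Qed.

Lemma J_eq (R : realType) d n (X : set int) : (0 < d)%N -> X `<=` nonneg_ints ->
  (forall m : int, 0 <= m -> scaled_frame d n m <-> X m) ->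
  J R d n = [set m%:~R | m in X].
Proof.
move=> d_gt0 X_ge0 eqX; rewrite J_scaled_frame //; congr image.
apply/seteqP; split=> m /= m_in.
  by apply/eqX => //; exact: scaled_frame_ge0 m_in.
by apply/eqX => //; exact: X_ge0.
Qed.

(** Zero is always a sum of squares, so necessity may assume [0 < m], as cancellation requires. For
    sufficiency [d %% 4] rows are enough, Lagrange blocks supplying the others. *)
Lemma J_I (R : realType) d n k : (0 < d <= n)%N ->
  (forall m : int, 0 < m -> scaled_frame d n m -> sums_of_squares k m) ->
  (forall a : 'I_k -> int,
     scaled_frame (d %% 4) (d %% 4 + (n - d)) (\sum_i a i ^+ 2)) ->
  J R d n = I_ R k.
Proof.
move=> /andP[d_gt0 le_dn] nec suf; apply: J_eq => // [|m m_ge0].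
  exact: sums_of_squares_ge0.
split=> [frame|[a mE]].
  have [->|m_neq0] := eqVneq m 0; first exact: sums_of_squares0.
  by apply: nec frame; rewrite lt0r m_neq0.
by apply: scaled_frame_extend => //; rewrite mE.
Qed.

(** A remainder [d %% 4] is at most 3, so its rows can be taken from a [4 x 4] Lagrange block once
    four columns are available. *)
Lemma J_N0 (R : realType) d n : (0 < d <= n)%N ->
  ((d %% 4 == 0) || (4 <= d %% 4 + (n - d)))%N -> J R d n = N0 R.
Proof.
move=> /andP[d_gt0 le_dn] dn; apply: J_eq => // m m_ge0; split=> // _.
apply: scaled_frame_extend => //.
have [/eqP ->|d4] := orP dn; first exact: scaled_frame0.
apply: (scaled_frame_widen d4); apply: (@scaled_frame_sub _ 4).
  by rewrite ltnW // ltn_pmod.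
exact: scaled_frame_lagrange.
Qed.

Unset Implicit Arguments.
Local Close Scope ring_scope.
Local Close Scope classical_set_scope.

Theorem theorem1 (R : realType) (d n : nat) (d_gt0 : 0 < d) (le_d_n : d <= n) :
  [/\ (n - d = 0 ->
        [/\ (d = 1 %[mod 4] -> J R d n = I_ R 1),
            (d = 2 %[mod 4] -> J R d n = I_ R 2),
            (d = 3 %[mod 4] -> J R d n = I_ R 1)
          & (d = 0 %[mod 4] -> J R d n = N0 R)]),
      (n - d = 1 ->
        [/\ (d = 1 %[mod 4] -> J R d n = I_ R 2),
            (d = 2 %[mod 4] -> J R d n = I_ R 2),
            (d = 3 %[mod 4] -> J R d n = N0 R)
          & (d = 0 %[mod 4] -> J R d n = N0 R)]),
      (n - d = 2 ->
        [/\ (d = 1 %[mod 4] -> J R d n = I_ R 3),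
            (d = 2 %[mod 4] -> J R d n = N0 R),
            (d = 3 %[mod 4] -> J R d n = N0 R)
          & (d = 0 %[mod 4] -> J R d n = N0 R)])
    & (3 <= n - d -> J R d n = N0 R)].
Proof.
have dn : 0 < d <= n by rewrite d_gt0.
have reduce m := @scaled_frame_reduce d n m le_d_n.
(* All cases with value [N0 R] close here. Six remain, with [(n - d, d mod 4)] equal to (0, 1), (0,
   2), (0, 3), (1, 1), (1, 2), (2, 1). *)
split=> [e|e|e|e]; [split=> r|split=> r|split=> r|]; try (by apply: J_N0 => //; lia).
- apply: J_I => // [m m_gt0 /(reduce m m_gt0)|a]; rewrite r e addn0.
    exact: scaled_frame1_sums.
  exact: scaled_frame1.
- apply: J_I => // [m m_gt0 /(reduce m m_gt0)|a]; rewrite r e addn0.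
    by move=> /(@scaled_frame_sub _ 2 1 _ _ isT); exact: scaled_frame1_sums.
  by rewrite big_ord_recl big_ord1; exact: scaled_frame22.
(* One row of a reduced [3 x 3] frame would only show three squares; the determinant of the full
   matrix gives a single one. *)
- apply: J_I => // [m m_gt0|a]; last by rewrite r e addn0 big_ord1; exact: scaled_frame_sqr.
  have -> : n = d by lia.
  by apply: scaled_frame_odd_square; lia.
- apply: J_I => // [m m_gt0 /(reduce m m_gt0)|a]; rewrite r e.
    exact: scaled_frame1_sums.
  exact: scaled_frame1.
- apply: J_I => // [m m_gt0 /(reduce m m_gt0)|a]; rewrite r e.
    move=> /scaled_frame_cross frame; apply: scaled_frame1_sums => //.
    by apply: scaled_frame_sub (frame _) => //; rewrite intr_eq0 gt_eqF.
  apply: (@scaled_frame_widen _ _ 2) => //.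
  by rewrite big_ord_recl big_ord1; exact: scaled_frame22.
- apply: J_I => // [m m_gt0 /(reduce m m_gt0)|a]; rewrite r e.
    exact: scaled_frame1_sums.
  exact: scaled_frame1.
Qed.
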